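(* Let $n\ge1$ and define $\varepsilon_n>0$ by $(1+\varepsilon_n)^2 = 1+8190\,e^{-n/10}$. For every $f(t)=\sum_{j=1}^na_je^{i\lambda_jt}$ with $a_j\in\mathbb{C}$ and real $\lambda_1<\cdots<\lambda_n$, $$\|f'\|_{[0,1]} \le 27(1+\varepsilon_n)\,n^{3/2}\left(\sum_{k=1}^n\left(2\left(\frac{\lambda_k}{9n}\right)^2+8(k-1)^2\right)\right)^{1/2}\|f\|_{L_2[0,1]}.$$
   Context: $\|g\|_{[0,1]}:=\sup_{t\in[0,1]}|g(t)|$; $\|f\|_{L_2[0,1]}=(\int_0^1|f|^2)^{1/2}$. *)

(* Defs.v *)
From Stdlib Require Import Reals List.
Open Scope R_scope.

Definition rsum (n : nat) (g : nat -> R) : R :=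
  fold_right (fun k acc => g k + acc) 0 (seq 0 n).

(* f(t) = sum_{j<n} a_j e^{i lam_j t}, with a_j = ar j + i ai j *)
Definition f_re (n : nat) (ar ai lam : nat -> R) (t : R) : R :=
  rsum n (fun j => ar j * cos (lam j * t) - ai j * sin (lam j * t)).
Definition f_im (n : nat) (ar ai lam : nat -> R) (t : R) : R :=
  rsum n (fun j => ar j * sin (lam j * t) + ai j * cos (lam j * t)).

(* f'(t) = sum_{j<n} a_j (i lam_j) e^{i lam_j t} *)
Definition df_re (n : nat) (ar ai lam : nat -> R) (t : R) : R :=
  rsum n (fun j => lam j * (- ar j * sin (lam j * t) - ai j * cos (lam j * t))).
Definition df_im (n : nat) (ar ai lam : nat -> R) (t : R) : R :=
  rsum n (fun j => lam j * (ar j * cos (lam j * t) - ai j * sin (lam j * t))).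

Definition cmod (x y : R) : R := sqrt (x ^ 2 + y ^ 2).

Definition eps_n (n : nat) : R := sqrt (1 + 8190 * exp (- INR n / 10)) - 1.

(* Main.v *)
(* Fix t and expand on the half interval of [0,1] starting at t, forwards or backwards, so that
   t becomes 0 and the half interval [0,1/2]. In L2 of the half line with weight exp(-r s),
   Gram-Schmidt is explicit (Malmquist-Takenaka): removing the first frequency l_1 turns
   f = sum a_j e^{i l_j s} into f_1 = sum_{j>1} a_j (i(l_j - l_1)) / (i(l_j - l_1) - r) e^{i l_j s},
   with (e^{-rs} |f - f_1|^2)' = -r e^{-rs} (|f|^2 - |f_1|^2) and
   f' - i l_1 f = f_1' - (r + i l_1) f_1.
   Iterating, f'(0) = sum_k (i l_k - r (k-1)) c_k with sum |c_k|^2 = r int_0^oo e^{-rs} |f|^2,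
   and Cauchy-Schwarz bounds |f'(0)|.
   To pass from the half line to [0,1/2], cut it into blocks of length d = 1/(2n).
   On unimodular nodes x_1, ..., x_n one has x^m = sum_{k<n} d_k x^k with sum |d_k| <= 3^m, so the
   L2 norm of f on the m-th block is at most 3^m times that on the first n blocks; with r = 9n
   the weight e^{-9m/2} beats 9^m, and the weighted integral is at most twice the one over
   [0,1/2]. This factor 2 is absorbed by the factors 2 and 8 in the theorem. *)

Require Import Defs.
From Stdlib Require Import Reals List Lra Lia.
From Coquelicot Require Import Coquelicot.
Open Scope R_scope.

(** * Exponential sums: derivative, continuity, boundedness *)

Definition cis (x : R) : C := (cos x, sin x).

Lemma Cmod_sqr (z : C) : Cmod z ^ 2 = fst z ^ 2 + snd z ^ 2.
Proof. unfold Cmod; apply pow2_sqrt; nra. Qed.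

Lemma cis_plus (x y : R) : cis (x + y) = (cis x * cis y)%C.
Proof.
unfold cis, Cmult; cbn; rewrite cos_plus, sin_plus; f_equal; ring.
Qed.

Lemma cis_INR (x : R) (m : nat) : cis (INR m * x) = (cis x ^ m)%C.
Proof.
induction m as [|m IH].
- simpl; rewrite Rmult_0_l; unfold cis; now rewrite cos_0, sin_0.
- rewrite S_INR, Cpow_S, <- IH, <- cis_plus; f_equal; ring.
Qed.

Lemma Cmod_cis (x : R) : Cmod (cis x) = 1.
Proof.
unfold Cmod, cis; cbn [fst snd].
replace (cos x ^ 2 + sin x ^ 2) with 1; [apply sqrt_1|].
generalize (sin2_cos2 x); unfold Rsqr; lra.
Qed.

(* A list of pairs (a, lam) encodes the sum of the a * exp(i lam t). *)
Definition esum (l : list (C * R)) (t : R) : C :=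
  fold_right (fun (p : C * R) (acc : C) => fst p * cis (snd p * t) + acc)%C 0%C l.

Definition desum (l : list (C * R)) (t : R) : C :=
  fold_right (fun (p : C * R) (acc : C) => Ci * snd p * (fst p * cis (snd p * t)) + acc)%C 0%C l.

Lemma esum_cons (a : C) (w : R) (l : list (C * R)) (t : R) :
  esum ((a, w) :: l) t = (a * cis (w * t) + esum l t)%C.
Proof. reflexivity. Qed.

Lemma desum_cons (a : C) (w : R) (l : list (C * R)) (t : R) :
  desum ((a, w) :: l) t = (Ci * w * (a * cis (w * t)) + desum l t)%C.
Proof. reflexivity. Qed.

Lemma is_derive_esum (l : list (C * R)) (t : R) :
  is_derive (fun s => fst (esum l s)) t (fst (desum l t)) /\
  is_derive (fun s => snd (esum l s)) t (snd (desum l t)).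
Proof.
induction l as [|[[x y] w] l [IH1 IH2]].
- cbn; split; apply @is_derive_const.
- split.
  + apply (is_derive_ext (fun s => x * cos (w * s) - y * sin (w * s) + fst (esum l s)));
      [reflexivity|].
    apply (is_derive_plus (K := R_AbsRing) (V := R_NormedModule)); [|exact IH1].
    auto_derive; [easy|cbn; ring].
  + apply (is_derive_ext (fun s => x * sin (w * s) + y * cos (w * s) + snd (esum l s)));
      [reflexivity|].
    apply (is_derive_plus (K := R_AbsRing) (V := R_NormedModule)); [|exact IH2].
    auto_derive; [easy|cbn; ring].
Qed.

Lemma is_derive_weighted_sqr (r t : R) (f g df dg : R -> R) :
  is_derive f t (df t) -> is_derive g t (dg t) ->
  is_derive (fun s => exp (- r * s) * (f s ^ 2 + g s ^ 2)) t
    (exp (- r * t) * (2 * (f t * df t + g t * dg t) - r * (f t ^ 2 + g t ^ 2))).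
Proof.
intros Hf Hg; auto_derive; [repeat split; eexists; eassumption|].
change (fun x => f x) with f; change (fun x => g x) with g.
rewrite (is_derive_unique _ _ _ Hf), (is_derive_unique _ _ _ Hg); ring.
Qed.

Lemma continuous_esum_sqr (l : list (C * R)) (t : R) :
  continuous (fun s => Cmod (esum l s) ^ 2) t.
Proof.
destruct (is_derive_esum l t) as [H1 H2].
(* Rate 0 makes the weight 1, so the weighted derivative formula applies as it stands. *)
apply (continuous_ext (fun s => exp (- 0 * s) * (fst (esum l s) ^ 2 + snd (esum l s) ^ 2))).
- intros s; rewrite Cmod_sqr, Ropp_0, Rmult_0_l, exp_0; apply Rmult_1_l.
- apply (ex_derive_continuous (K := R_AbsRing) (V := R_NormedModule)); eexists.
  exact (is_derive_weighted_sqr 0 t _ _ (fun s => fst (desum l s)) (fun s => snd (desum l s)) H1 H2).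
Qed.

Lemma ex_RInt_esum_sqr (l : list (C * R)) (a b : R) :
  ex_RInt (fun s => Cmod (esum l s) ^ 2) a b.
Proof. apply (ex_RInt_continuous (V := R_CompleteNormedModule)); intros z _; apply continuous_esum_sqr. Qed.

Lemma continuous_weight (r t : R) : continuous (fun s => exp (- r * s)) t.
Proof. apply (ex_derive_continuous (K := R_AbsRing) (V := R_NormedModule)); now auto_derive. Qed.

Lemma continuous_weighted_esum_sqr (r : R) (l : list (C * R)) (t : R) :
  continuous (fun s => exp (- r * s) * Cmod (esum l s) ^ 2) t.
Proof.
apply (continuous_mult (U := R_UniformSpace) (K := R_AbsRing) (fun s => exp (- r * s))).
- apply continuous_weight.
- apply continuous_esum_sqr.
Qed.

Lemma ex_RInt_weighted (r : R) (l : list (C * R)) (a b : R) :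
  ex_RInt (fun s => exp (- r * s) * Cmod (esum l s) ^ 2) a b.
Proof.
apply (ex_RInt_continuous (V := R_CompleteNormedModule)); intros z _; apply continuous_weighted_esum_sqr.
Qed.

(** Ensures that the boundary term at [T] in the energy identity is O(exp(-r T)). *)
Lemma esum_bounded (l : list (C * R)) :
  exists B, 0 <= B /\ forall t, Cmod (esum l t) <= B.
Proof.
induction l as [|[a w] l [B [HB IH]]].
- exists 0; split; [lra|]; intros t; change (Cmod 0 <= 0); rewrite Cmod_0; lra.
- exists (Cmod a + B); split; [generalize (Cmod_ge_0 a); lra|].
  intros t; rewrite esum_cons; eapply Rle_trans; [apply Cmod_triangle|].
  rewrite Cmod_mult, Cmod_cis; generalize (IH t); lra.
Qed.

(** * Removing one frequency: explicit Gram-Schmidt on the half line *)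

(* Inverts the all-pass factor (z - r - i w)/(z - i w) on Laplace transforms of exponential sums. *)
Definition peel (r w : R) (l : list (C * R)) : list (C * R) :=
  map (fun p : C * R => (fst p * (Ci * (snd p - w)%R) / (Ci * (snd p - w)%R - r), snd p)%C) l.

Lemma Ci_mult_minus_neq_0 (r x : R) : 0 < r -> (Ci * x - r)%C <> 0%C.
Proof.
intros Hr H; apply (f_equal fst) in H; cbn in H; lra.
Qed.

(** Compare the coefficients of each exponential. The operator f' - i w f kills the leading term. At
    frequency v, it multiplies by i(v - w), while the right side multiplies by i(v - w) - r, the
    denominator in [peel]. *)
Lemma peel_relation (r w : R) (a : C) (l : list (C * R)) (t : R) : 0 < r ->
  (desum ((a, w) :: l) t - Ci * w * esum ((a, w) :: l) t
   = desum (peel r w l) t - (r + Ci * w) * esum (peel r w l) t)%C.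
Proof.
intros Hr.
assert (H : (desum l t - Ci * w * esum l t
   = desum (peel r w l) t - (r + Ci * w) * esum (peel r w l) t)%C).
{ induction l as [|[b v] l IH]; [cbn; ring|].
  cbn [peel map fst snd]; fold (peel r w l).
  rewrite !esum_cons, !desum_cons.
  set (z := cis (v * t)).
  assert (Hd := Ci_mult_minus_neq_0 r (v - w) Hr).
  replace (Ci * v * (b * z) + desum l t - Ci * w * (b * z + esum l t))%C
    with (Ci * (v - w)%R * (b * z) + (desum l t - Ci * w * esum l t))%C
    by (rewrite RtoC_minus; ring).
  rewrite IH.
  rewrite RtoC_minus in Hd |- *. field. exact Hd. }
rewrite esum_cons, desum_cons, <- H; ring.
Qed.

(** Let g be the peeled sum and h = f - g. [peel_relation] reads h' = i w h - r g; the rotation i w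
    h does not change |h|, so the derivative of exp(-r s)|h|^2 is -r exp(-r s)(|h|^2 + 2 Re(conj(h)
    g)), and the bracket is |h + g|^2 - |g|^2 with h + g = f. *)
Lemma is_derive_peel_energy (r w : R) (a : C) (l : list (C * R)) (t : R) : 0 < r ->
  is_derive
    (fun s => exp (- r * s) * Cmod (esum ((a, w) :: l) s - esum (peel r w l) s) ^ 2) t
    (r * (exp (- r * t) * Cmod (esum (peel r w l) t) ^ 2)
     - r * (exp (- r * t) * Cmod (esum ((a, w) :: l) t) ^ 2)).
Proof.
intros Hr.
assert (Hrel := peel_relation r w a l t Hr).
destruct (is_derive_esum ((a, w) :: l) t) as [Hx Hy].
destruct (is_derive_esum (peel r w l) t) as [Hx1 Hy1].
revert Hrel Hx Hy Hx1 Hy1.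
generalize (esum ((a, w) :: l)) (desum ((a, w) :: l)) (esum (peel r w l)) (desum (peel r w l)).
intros f df g dg Hrel Hx Hy Hx1 Hy1.
apply (is_derive_ext (fun s => exp (- r * s)
  * ((fst (f s) - fst (g s)) ^ 2 + (snd (f s) - snd (g s)) ^ 2))).
{ intros s; rewrite Cmod_sqr; reflexivity. }
assert (Hd := is_derive_weighted_sqr r t _ _ (fun s => fst (df s) - fst (dg s))
  (fun s => snd (df s) - snd (dg s))
  (is_derive_minus (K := R_AbsRing) (V := R_NormedModule) _ _ _ _ _ Hx Hx1)
  (is_derive_minus (K := R_AbsRing) (V := R_NormedModule) _ _ _ _ _ Hy Hy1)).
eapply eq_rect; [exact Hd|].
rewrite !Cmod_sqr.
assert (H1 := f_equal fst Hrel); assert (H2 := f_equal snd Hrel); cbn in H1, H2.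
change minus with Rminus in *; change (@minus R_AbelianGroup) with Rminus in *.
cbn -[pow].
replace (fst (df t) - fst (dg t)) with (- w * snd (f t) - r * fst (g t) + w * snd (g t)) by lra.
replace (snd (df t) - snd (dg t)) with (w * fst (f t) - r * snd (g t) - w * fst (g t)) by lra.
ring.
Qed.

(** The integrated form on [0, T]; a finite [T] avoids improper integrals, at the price of a
    boundary term. *)
Lemma peel_energy (r w : R) (a : C) (l : list (C * R)) (T : R) : 0 < r ->
  r * RInt (fun s => exp (- r * s) * Cmod (esum ((a, w) :: l) s) ^ 2) 0 T
  = Cmod (esum ((a, w) :: l) 0 - esum (peel r w l) 0) ^ 2
    - exp (- r * T) * Cmod (esum ((a, w) :: l) T - esum (peel r w l) T) ^ 2
    + r * RInt (fun s => exp (- r * s) * Cmod (esum (peel r w l) s) ^ 2) 0 T.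
Proof.
intros Hr.
set (F := fun s => exp (- r * s) * Cmod (esum ((a, w) :: l) s) ^ 2).
set (G := fun s => exp (- r * s) * Cmod (esum (peel r w l) s) ^ 2).
assert (HF : is_RInt (fun s => r * F s) 0 T (r * RInt F 0 T)).
{ apply (is_RInt_scal (V := R_NormedModule)), (RInt_correct (V := R_CompleteNormedModule)).
  apply ex_RInt_weighted. }
assert (HG : is_RInt (fun s => r * G s) 0 T (r * RInt G 0 T)).
{ apply (is_RInt_scal (V := R_NormedModule)), (RInt_correct (V := R_CompleteNormedModule)).
  apply ex_RInt_weighted. }
assert (HGF := is_RInt_minus (V := R_NormedModule) _ _ _ _ _ _ HG HF).
assert (HD := is_RInt_derive (V := R_CompleteNormedModule)
  (fun s => exp (- r * s) * Cmod (esum ((a, w) :: l) s - esum (peel r w l) s) ^ 2)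
  (fun s => r * G s - r * F s) 0 T
  (fun s _ => is_derive_peel_energy r w a l s Hr)).
apply (is_RInt_unique (V := R_CompleteNormedModule)) in HGF.
apply (is_RInt_unique (V := R_CompleteNormedModule)) in HD.
- assert (E := eq_trans (eq_sym HGF) HD).
  change (r * RInt G 0 T - r * RInt F 0 T
    = exp (- r * T) * Cmod (esum ((a, w) :: l) T - esum (peel r w l) T) ^ 2
      - exp (- r * 0) * Cmod (esum ((a, w) :: l) 0 - esum (peel r w l) 0) ^ 2) in E.
  rewrite Rmult_0_r, exp_0 in E; lra.
- intros s _.
  apply (continuous_minus (V := R_NormedModule));
    apply (continuous_scal_r (V := R_NormedModule)); apply continuous_weighted_esum_sqr.
Qed.

(** * Cauchy-Schwarz bound for the derivative at 0 *)

(** The sum of |i lam_k - (g + r k)|^2, k counted from 0: these are the coefficients of f'(0) - g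
    f(0) in terms of the values c_k split off by successive peelings. *)
Fixpoint weight (r g : R) (l : list (C * R)) : R :=
  match l with
  | nil => 0
  | p :: l' => snd p ^ 2 + g ^ 2 + weight r (g + r) l'
  end.

Lemma weight_nonneg (r : R) (l : list (C * R)) : forall g, 0 <= weight r g l.
Proof.
induction l as [|p l IH]; intros g; cbn [weight]; [lra|].
generalize (IH (g + r)) (pow2_ge_0 (snd p)) (pow2_ge_0 g); lra.
Qed.

Lemma weight_peel (r w : R) (l : list (C * R)) :
  forall g, weight r g (peel r w l) = weight r g l.
Proof.
induction l as [|p l IH]; intros g; [reflexivity|].
cbn [peel map weight snd]; fold (peel r w l); now rewrite IH.
Qed.

(** The induction step of Cauchy-Schwarz: [x] is the part of the scalar product already bounded, and
    y z is one further product. *)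
Lemma Cmod_sqr_cauchy_schwarz (x y z : C) (A P : R) :
  0 <= A -> 0 <= P -> Cmod x ^ 2 <= A * P ->
  Cmod (x + y * z) ^ 2 <= (Cmod y ^ 2 + A) * (Cmod z ^ 2 + P).
Proof.
intros HA HP Hx.
assert (H : Cmod (x + y * z) <= Cmod x + Cmod y * Cmod z)
  by (rewrite <- Cmod_mult; apply Cmod_triangle).
assert (H0 := Cmod_ge_0 (x + y * z)).
assert (H1 := Cmod_ge_0 x); assert (H2 := Cmod_ge_0 y); assert (H3 := Cmod_ge_0 z).
set (c := Cmod (x + y * z)) in *; set (u := Cmod x) in *; set (v := Cmod y) in *;
  set (s := Cmod z) in *.
assert (E1 : u <= sqrt A * sqrt P).
{ rewrite <- sqrt_mult by assumption; rewrite <- (sqrt_pow2 u) by assumption.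
  now apply sqrt_le_1_alt. }
assert (E2 := pow2_sqrt A HA); assert (E3 := pow2_sqrt P HP).
set (p := sqrt A) in *; set (q := sqrt P) in *.
assert (Hc : c ^ 2 <= (p * q + v * s) ^ 2) by (apply pow_incr; lra).
rewrite <- E2, <- E3.
(* Lagrange's identity: this square is the difference of the two sides. *)
assert (0 <= (v * q - s * p) ^ 2) by apply pow2_ge_0.
nra.
Qed.

(** Each peeling raises the shift by [r], hence the general [g]; it also changes the coefficients of
    the tail, hence the induction on the length. [B] does not depend on [T] and collects the
    boundary terms. *)
Lemma desum_bound_weighted (r : R) (n : nat) : 0 < r ->
  forall (l : list (C * R)) (g : R), length l = n ->
  exists B, 0 <= B /\ forall T, 0 <= T ->
    Cmod (desum l 0 - g * esum l 0) ^ 2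
    <= weight r g l
       * (r * RInt (fun s => exp (- r * s) * Cmod (esum l s) ^ 2) 0 T + B * exp (- r * T)).
Proof.
intros Hr; induction n as [|n IH]; intros [|[a w] l] g Hn; try discriminate Hn.
- exists 0; split; [lra|]; intros T HT; cbn [weight]; rewrite Rmult_0_l.
  replace (desum nil 0 - g * esum nil 0)%C with (RtoC 0) by (cbn; ring).
  rewrite Cmod_0; lra.
- destruct (IH (peel r w l) (g + r)) as [B [HB HI]].
  { unfold peel; rewrite length_map; now injection Hn. }
  destruct (esum_bounded ((a, w) :: l)) as [B1 [HB1 HI1]].
  destruct (esum_bounded (peel r w l)) as [B2 [HB2 HI2]].
  exists (B + (B1 + B2) ^ 2); split; [generalize (pow2_ge_0 (B1 + B2)); lra|].
  intros T HT; specialize (HI T HT).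
  rewrite (peel_energy r w a l T Hr).
  assert (Hrel := peel_relation r w a l 0 Hr).
  assert (HcT : Cmod (esum ((a, w) :: l) T - esum (peel r w l) T) <= B1 + B2).
  { unfold Cminus; eapply Rle_trans; [apply Cmod_triangle|].
    rewrite Cmod_opp; generalize (HI1 T) (HI2 T); lra. }
  apply (fun H => pow_incr _ _ 2 (conj (Cmod_ge_0 _) H)) in HcT.
  assert (He := exp_pos (- r * T)).
  revert Hrel HI HcT.
  set (cT := Cmod (esum _ T - _)).
  (* Split f(0) = c + f_1(0), where f_1 is the peeled sum. *)
  replace (esum ((a, w) :: l) 0) with
    ((esum ((a, w) :: l) 0 - esum (peel r w l) 0) + esum (peel r w l) 0)%C at 1 2 by ring.
  set (c := (esum ((a, w) :: l) 0 - _)%C).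
  intros Hrel HI HcT.
  rewrite weight_peel in HI.
  set (I := RInt _ 0 T) in *.
  assert (HI0 : 0 <= I).
  { apply RInt_ge_0; [exact HT|apply ex_RInt_weighted|].
    intros s _; apply Rmult_le_pos; [left; apply exp_pos|apply pow2_ge_0]. }
  (* One new product (i w - g) c appears, and the rest is the same expression for f_1 with shift g +
     r. *)
  replace (desum ((a, w) :: l) 0 - g * (c + esum (peel r w l) 0))%C
    with ((desum (peel r w l) 0 - (g + r)%R * esum (peel r w l) 0) + (Ci * w - g) * c)%C.
  2: { rewrite RtoC_plus.
       transitivity ((desum ((a, w) :: l) 0 - Ci * w * (c + esum (peel r w l) 0))
         + (Ci * w - g) * (c + esum (peel r w l) 0))%C; [rewrite Hrel|]; ring. }
  eapply Rle_trans.
  { apply Cmod_sqr_cauchy_schwarz; [apply (weight_nonneg r l (g + r))| |exact HI].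
    apply Rplus_le_le_0_compat; apply Rmult_le_pos; lra. }
  cbn [weight snd].
  replace (Cmod (Ci * w - g) ^ 2) with (w ^ 2 + g ^ 2) by (rewrite Cmod_sqr; cbn; ring).
  apply Rmult_le_compat_l.
  { generalize (weight_nonneg r l (g + r)) (pow2_ge_0 w) (pow2_ge_0 g); lra. }
  nra.
Qed.

(** * Interpolation of powers at unimodular nodes *)

(* The action on a sequence, at position k, of the polynomial in the shift with coefficients p. *)
Fixpoint shift_eval (p : list C) (u : nat -> C) (k : nat) : C :=
  match p with
  | nil => 0%C
  | c :: p' => (c * u k + shift_eval p' u (S k))%C
  end.

Definition l1norm (p : list C) : R := fold_right (fun c acc => Cmod c + acc) 0 p.

Lemma l1norm_nonneg (p : list C) : 0 <= l1norm p.
Proof.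
induction p as [|c p IH]; cbn; [lra|fold (l1norm p); generalize (Cmod_ge_0 c); lra].
Qed.

(** Geometric sequences are eigenvectors of the shift; this turns prepending a coefficient into
    multiplication by X. *)
Lemma shift_eval_pow (x : C) (p : list C) (k : nat) :
  shift_eval p (Cpow x) (S k) = (x * shift_eval p (Cpow x) k)%C.
Proof.
revert k; induction p as [|c p IH]; intros k; cbn [shift_eval]; [ring|].
rewrite IH, Cpow_S; ring.
Qed.

Fixpoint axpy (z : C) (p q : list C) : list C :=
  match p, q with
  | c :: p', d :: q' => (z * c + d)%C :: axpy z p' q'
  | nil, _ => q
  | _, nil => map (Cmult z) p
  end.

Lemma shift_eval_scal (z : C) (p : list C) (u : nat -> C) :
  forall k, shift_eval (map (Cmult z) p) u k = (z * shift_eval p u k)%C.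
Proof.
induction p as [|c p IH]; intros k; cbn [map shift_eval]; [ring|rewrite IH; ring].
Qed.

Lemma l1norm_scal (z : C) (p : list C) : l1norm (map (Cmult z) p) = Cmod z * l1norm p.
Proof.
induction p as [|c p IH]; cbn; [ring|].
fold (l1norm p) (l1norm (map (Cmult z) p)); rewrite IH, Cmod_mult; ring.
Qed.

Lemma shift_eval_axpy (z : C) (u : nat -> C) (p q : list C) :
  forall k, shift_eval (axpy z p q) u k = (z * shift_eval p u k + shift_eval q u k)%C.
Proof.
revert q; induction p as [|c p IH]; intros [|d q] k; cbn [axpy]; try (cbn; ring).
- rewrite shift_eval_scal; cbn [shift_eval]; ring.
- cbn [shift_eval]; rewrite IH; ring.
Qed.

Lemma l1norm_axpy (z : C) (p q : list C) :
  l1norm (axpy z p q) <= Cmod z * l1norm p + l1norm q.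
Proof.
revert q; induction p as [|c p IH]; intros [|d q]; cbn [axpy].
- cbn; lra.
- cbn; lra.
- rewrite l1norm_scal; cbn; lra.
- cbn; fold (l1norm p) (l1norm q) (l1norm (axpy z p q)).
  generalize (IH q) (Cmod_triangle (z * c) d); rewrite Cmod_mult; lra.
Qed.

Lemma length_axpy (z : C) (p q : list C) :
  length (axpy z p q) = Nat.max (length p) (length q).
Proof.
revert q; induction p as [|c p IH]; intros [|d q]; cbn; try rewrite length_map; try easy.
now rewrite IH.
Qed.

(* The remainder of X^m modulo prod (X - x_j) has small coefficients. Dividing first by
   X - x_0 gives X^m = x_0^m + (X - x_0) * sum_{i<m} x_0^(m-1-i) X^i, where each X^i is
   then reduced modulo the remaining nodes, so the bound obeys 1 + 2 (1 + 3 + ... + 3^(m-1)) = 3^m. *)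
Lemma power_interpolation (xs : list C) : (forall x, In x xs -> Cmod x = 1) ->
  forall m, exists p, (length p <= length xs)%nat /\ l1norm p <= 3 ^ m /\
    forall x, In x xs -> (x ^ m)%C = shift_eval p (Cpow x) 0.
Proof.
induction xs as [|x0 xs IH]; intros Hxs m.
- exists nil; repeat split; [cbn; lia|cbn; apply pow_le; lra|intros x []].
- assert (Hx0 : Cmod x0 = 1) by (apply Hxs; now left).
  specialize (IH (fun x Hx => Hxs x (or_intror Hx))).
  (* [q] represents the quotient (X^m - x0^m)/(X - x0), reduced modulo the remaining nodes. *)
  assert (Hq : exists q, (length q <= length xs)%nat /\ 2 * l1norm q <= 3 ^ m - 1 /\
    forall x, In x xs ->
      (x ^ m)%C = (x0 ^ m + (x - x0) * shift_eval q (Cpow x) 0)%C).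
  { clear - IH Hx0; induction m as [|m [q [Hq1 [Hq2 Hq3]]]].
    - exists nil; repeat split; [cbn; lia|cbn; lra|intros x _; cbn; ring].
    - destruct (IH m) as [p [Hp1 [Hp2 Hp3]]].
      (* The quotients satisfy Q_(m+1) = x0 Q_m + X^m, with X^m replaced by its remainder [p]; the
         norm bound follows from (3^m - 1) + 2 * 3^m = 3^(m+1) - 1. *)
      exists (axpy x0 q p); repeat split.
      + rewrite length_axpy; lia.
      + generalize (l1norm_axpy x0 q p); rewrite Hx0; cbn [pow]; lra.
      + intros x Hx; rewrite shift_eval_axpy, <- (Hp3 x Hx), !Cpow_S.
        transitivity ((x - x0) * x ^ m + x0 * x ^ m)%C; [ring|].
        rewrite (Hq3 x Hx) at 2; ring. }
  destruct Hq as [q [Hq1 [Hq2 Hq3]]].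
  (* This is x0^m + (X - x0) q, where the list [x0 ^ m :: q] stands for x0^m + X q. *)
  exists (axpy (- x0) q ((x0 ^ m)%C :: q)); repeat split.
  + rewrite length_axpy; cbn [length]; lia.
  + eapply Rle_trans; [apply l1norm_axpy|].
    cbn [l1norm fold_right]; fold (l1norm q).
    rewrite Cmod_opp, Cmod_pow, Hx0, pow1; lra.
  + intros x Hx; rewrite shift_eval_axpy; cbn [shift_eval]; rewrite shift_eval_pow.
    cbn [Cpow]; destruct Hx as [<-|Hx]; [ring|].
    rewrite (Hq3 x Hx); ring.
Qed.

(** Along the step [d] every term is geometric with ratio [cis (w * d)], one of the nodes, so the
    interpolation identity holds term by term and passes to the sum by linearity. *)
Lemma esum_shift (l : list (C * R)) (d : R) (m : nat) (p : list C) :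
  (forall x, In x (map (fun q => cis (snd q * d)) l) ->
    (x ^ m)%C = shift_eval p (Cpow x) 0) ->
  forall s, esum l (s + INR m * d) = shift_eval p (fun k => esum l (s + INR k * d)) 0.
Proof.
intros H s.
assert (Hadd : forall (p : list C) u v (z : C) k,
  shift_eval p (fun j => z * u j + v j)%C k = (z * shift_eval p u k + shift_eval p v k)%C).
{ clear; induction p as [|c p IH]; intros u v z k; cbn [shift_eval]; [ring|rewrite IH; ring]. }
assert (Hext : forall (p : list C) u v k, (forall j, u j = v j) ->
  shift_eval p u k = shift_eval p v k).
{ clear; induction p as [|c p IH]; intros u v k E; cbn [shift_eval]; [easy|].
  now rewrite E, (IH u v). }
assert (Hterm : forall w j, cis (w * (s + INR j * d)) = (cis (w * s) * cis (w * d) ^ j)%C).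
{ intros w j; rewrite <- cis_INR, <- cis_plus; f_equal; ring. }
induction l as [|[a w] l IH].
- symmetry; transitivity (shift_eval p (fun k => 0 * 0 + 0)%C 0).
  + apply Hext; intros j; cbn; ring.
  + rewrite (Hadd p (fun _ => RtoC 0) (fun _ => RtoC 0)).
    assert (Hz : forall k, shift_eval p (fun _ => RtoC 0) k = 0%C).
    { clear; induction p as [|c p IH]; intros k; cbn [shift_eval]; [easy|rewrite IH; ring]. }
    rewrite !Hz; cbn; ring.
- rewrite esum_cons, Hterm, IH by (intros x Hx; apply H; now right).
  rewrite (H (cis (w * d))) by now left.
  rewrite (Hext p (fun k => esum ((a, w) :: l) (s + INR k * d))
    (fun k => (a * cis (w * s)) * cis (w * d) ^ k + esum l (s + INR k * d))%C).
  + rewrite Hadd; ring.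
  + intros j; rewrite esum_cons, Hterm; ring.
Qed.

Lemma shift_eval_bound (p : list C) (u : nat -> C) (M : R) :
  forall k, (forall j, (k <= j < k + length p)%nat -> Cmod (u j) <= M) ->
  Cmod (shift_eval p u k) <= l1norm p * M.
Proof.
induction p as [|c p IH]; intros k Hu; cbn [shift_eval].
- rewrite Cmod_0; cbn; lra.
- eapply Rle_trans; [apply Cmod_triangle|].
  assert (H1 := IH (S k) (fun j Hj => Hu j ltac:(cbn [length]; lia))).
  assert (H2 := Hu k ltac:(cbn [length]; lia)).
  rewrite Cmod_mult; cbn; fold (l1norm p).
  assert (H3 := Rmult_le_compat_l _ _ _ (Cmod_ge_0 c) H2); lra.
Qed.

(** Interpolation bounds the sample by 3^m times the largest of the first n samples. The squared
    maximum is relaxed to the sum of squares, which can be integrated block by block. *)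
Lemma esum_sqr_shift_bound (l : list (C * R)) (d s : R) (m : nat) :
  Cmod (esum l (s + INR m * d)) ^ 2
  <= 9 ^ m * rsum (length l) (fun k => Cmod (esum l (s + INR k * d)) ^ 2).
Proof.
destruct (power_interpolation (map (fun q => cis (snd q * d)) l)) with (m := m)
  as [p [Hp1 [Hp2 Hp3]]].
{ intros x Hx; apply in_map_iff in Hx; destruct Hx as [q [<- _]]; apply Cmod_cis. }
rewrite length_map in Hp1.
rewrite (esum_shift l d m p Hp3).
set (u := fun k => esum l (s + INR k * d)).
set (Q := rsum (length l) (fun k => Cmod (u k) ^ 2)).
change (Cmod (shift_eval p u 0) ^ 2 <= 9 ^ m * Q).
assert (HQ : 0 <= Q /\ forall j, (j < length l)%nat -> Cmod (u j) ^ 2 <= Q).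
{ unfold Q, rsum.
  assert (Hg : forall n b, let S := fold_right (fun k acc => Cmod (u k) ^ 2 + acc) 0 (seq b n) in
    0 <= S /\ forall j, (b <= j < b + n)%nat -> Cmod (u j) ^ 2 <= S).
  { clear; induction n as [|n IH]; intros b; cbn [seq fold_right]; cbv zeta.
    - split; [lra|lia].
    - destruct (IH (S b)) as [H1 H2]; assert (H3 := pow2_ge_0 (Cmod (u b))); split; [lra|].
      intros j Hj; destruct (Nat.eq_dec j b) as [->|Hne]; [lra|].
      assert (H4 := H2 j ltac:(lia)); lra. }
  destruct (Hg (length l) 0%nat) as [H1 H2]; split; [exact H1|].
  intros j Hj; apply H2; lia. }
destruct HQ as [HQ HM].
assert (H : Cmod (shift_eval p u 0) <= 3 ^ m * sqrt Q).
{ eapply Rle_trans; [apply (shift_eval_bound p u (sqrt Q))|].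
  - intros j Hj; rewrite <- (sqrt_pow2 (Cmod (u j))) by apply Cmod_ge_0.
    apply sqrt_le_1_alt, HM; lia.
  - apply Rmult_le_compat_r; [apply sqrt_pos|exact Hp2]. }
apply (fun H => pow_incr _ _ 2 (conj (Cmod_ge_0 _) H)) in H.
rewrite Rpow_mult_distr, (pow2_sqrt Q HQ), <- pow_mult, Nat.mul_comm, pow_mult in H.
replace (3 ^ 2) with 9 in H by ring.
exact H.
Qed.

(** * From the weighted half line to a finite interval *)

Lemma exp_pow (x : R) (m : nat) : exp x ^ m = exp (INR m * x).
Proof.
induction m as [|m IH]; [cbn; now rewrite Rmult_0_l, exp_0|].
rewrite S_INR; cbn [pow]; rewrite IH, <- exp_plus; f_equal; ring.
Qed.

Lemma exp_le_compat (x y : R) : x <= y -> exp x <= exp y.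
Proof.
intros [H | ->]; [left; now apply exp_increasing|right; reflexivity].
Qed.

Lemma RInt_affine (F : R -> R) (u v a b : R) : (forall x, continuous F x) ->
  u * RInt (fun s => F (u * s + v)) a b = RInt F (u * a + v) (u * b + v).
Proof.
intros HF.
rewrite <- (RInt_comp_lin (V := R_CompleteNormedModule) F u v a b).
- symmetry; apply (RInt_scal (V := R_CompleteNormedModule)).
  apply (ex_RInt_continuous (V := R_CompleteNormedModule)); intros z _.
  apply (continuous_comp (fun s => u * s + v) F); [|apply HF].
  apply (ex_derive_continuous (K := R_AbsRing) (V := R_NormedModule)); now auto_derive.
- apply (ex_RInt_continuous (V := R_CompleteNormedModule)); auto.
Qed.

Lemma RInt_shift (F : R -> R) (v a b : R) : (forall x, continuous F x) ->
  RInt (fun s => F (s + v)) a b = RInt F (a + v) (b + v).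
Proof.
intros HF; assert (H := RInt_affine F 1 v a b HF).
rewrite !Rmult_1_l in H; rewrite <- H.
apply RInt_ext; intros x _; now rewrite Rmult_1_l.
Qed.

Lemma RInt_blocks (F : R -> R) (d : R) (n : nat) : (forall x, continuous F x) ->
  is_RInt (fun s => rsum n (fun k => F (s + INR k * d))) 0 d (RInt F 0 (INR n * d)).
Proof.
intros HF; assert (Hex : forall a b, ex_RInt F a b).
{ intros a b; apply (ex_RInt_continuous (V := R_CompleteNormedModule)); auto. }
induction n as [|n IH].
- cbn [rsum seq fold_right]; rewrite Rmult_0_l, RInt_point; change zero with 0.
  assert (H := is_RInt_const (V := R_NormedModule) 0 d 0).
  change (scal (d - 0) 0) with ((d - 0) * 0) in H.
  rewrite Rmult_0_r in H; exact H.
- apply (is_RInt_ext (fun s => rsum n (fun k => F (s + INR k * d)) + F (s + INR n * d))).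
  (* The sum is split at its last index, so that the new block extends the interval on the right. *)
  { intros s _; unfold rsum; rewrite seq_S, fold_right_app.
    cbn [Nat.add fold_right]; rewrite Rplus_0_r.
    generalize (F (s + INR n * d)) (seq 0 n); intros x ks.
    induction ks as [|k ks IHk]; cbn [fold_right];
      [apply Rplus_0_l|rewrite <- IHk; apply Rplus_assoc]. }
  rewrite <- (RInt_Chasles (V := R_CompleteNormedModule) F 0 (INR n * d) (INR (S n) * d)) by auto.
  apply (is_RInt_plus (V := R_NormedModule)); [exact IH|].
  replace (RInt F (INR n * d) (INR (S n) * d)) with (RInt (fun s => F (s + INR n * d)) 0 d).
  + apply (RInt_correct (V := R_CompleteNormedModule)).
    apply (ex_RInt_continuous (V := R_CompleteNormedModule)); intros z _.
    apply (continuous_comp (fun s => s + INR n * d) F); [|apply HF].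
    apply (ex_derive_continuous (K := R_AbsRing) (V := R_NormedModule)); now auto_derive.
  + rewrite RInt_shift by exact HF; f_equal; [|rewrite S_INR]; ring.
Qed.

(** On block m the weight is at most exp(-r d)^m, and the shift bound contributes 9^m; summing the
    samples of the first n blocks rebuilds the unweighted integral. *)
Lemma weighted_block_bound (l : list (C * R)) (r d : R) (m : nat) : 0 < r -> 0 < d ->
  RInt (fun s => exp (- r * s) * Cmod (esum l s) ^ 2) (INR m * d) (INR (S m) * d)
  <= (9 * exp (- r * d)) ^ m
     * RInt (fun s => Cmod (esum l s) ^ 2) 0 (INR (length l) * d).
Proof.
intros Hr Hd.
set (F := fun s => Cmod (esum l s) ^ 2).
assert (HF : forall x, continuous F x) by (intros x; apply continuous_esum_sqr).
assert (Hblk := RInt_blocks F d (length l) HF).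
set (I := RInt F 0 (INR (length l) * d)) in *.
replace (INR m * d) with (0 + INR m * d) by ring.
replace (INR (S m) * d) with (d + INR m * d) by (rewrite S_INR; ring).
rewrite <- (RInt_shift (fun s => exp (- r * s) * Cmod (esum l s) ^ 2))
  by (intros x; apply continuous_weighted_esum_sqr).
assert (Hs := is_RInt_scal (V := R_NormedModule) _ _ _ ((9 * exp (- r * d)) ^ m) _ Hblk).
change (scal ((9 * exp (- r * d)) ^ m) I) with ((9 * exp (- r * d)) ^ m * I) in Hs.
rewrite <- (is_RInt_unique (V := R_CompleteNormedModule) _ _ _ _ Hs).
apply RInt_le; [lra| |eexists; exact Hs|].
- apply (ex_RInt_continuous (V := R_CompleteNormedModule)); intros z _.
  apply (continuous_comp (fun s => s + INR m * d)
    (fun s => exp (- r * s) * Cmod (esum l s) ^ 2)).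
  + apply (ex_derive_continuous (K := R_AbsRing) (V := R_NormedModule)); now auto_derive.
  + apply continuous_weighted_esum_sqr.
- intros s Hs0.
  change (exp (- r * (s + INR m * d)) * F (s + INR m * d)
    <= (9 * exp (- r * d)) ^ m * rsum (length l) (fun k => F (s + INR k * d))).
  assert (He : exp (- r * (s + INR m * d)) <= exp (- r * d) ^ m).
  { rewrite exp_pow; apply exp_le_compat; nra. }
  rewrite Rpow_mult_distr.
  replace (9 ^ m * exp (- r * d) ^ m * rsum (length l) (fun k => F (s + INR k * d)))
    with (exp (- r * d) ^ m * (9 ^ m * rsum (length l) (fun k => F (s + INR k * d)))) by ring.
  apply Rmult_le_compat; [left; apply exp_pos|apply pow2_ge_0|exact He|].
  apply esum_sqr_shift_bound.
Qed.

(** A geometric series. The first n blocks have weight at most 1. Block n + j contributes at most a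
    factor 2^-(n+j), hence at most 2^-(j+1) as n >= 1, and 1 + 1/2 + ... + 2^-p = 2 - 2^-p. *)
Lemma weighted_integral_bound (l : list (C * R)) (r d : R) : 0 < r -> 0 < d ->
  (1 <= length l)%nat -> 9 * exp (- r * d) <= 1 / 2 -> forall p,
  RInt (fun s => exp (- r * s) * Cmod (esum l s) ^ 2) 0 (INR (length l + p) * d)
  <= (2 - (1 / 2) ^ p) * RInt (fun s => Cmod (esum l s) ^ 2) 0 (INR (length l) * d).
Proof.
intros Hr Hd Hl Hq p.
assert (Hnd : 0 <= INR (length l) * d) by (apply Rmult_le_pos; [apply pos_INR|lra]).
assert (HI : 0 <= RInt (fun s => Cmod (esum l s) ^ 2) 0 (INR (length l) * d)).
{ apply RInt_ge_0; [exact Hnd|apply ex_RInt_esum_sqr|intros; apply pow2_ge_0]. }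
induction p as [|p IH].
- rewrite Nat.add_0_r; cbn [pow].
  replace (2 - 1) with 1 by ring; rewrite Rmult_1_l.
  apply RInt_le; [exact Hnd|apply ex_RInt_weighted|apply ex_RInt_esum_sqr|].
  intros s Hs; rewrite <- (Rmult_1_l (Cmod (esum l s) ^ 2)) at 2.
  apply Rmult_le_compat_r; [apply pow2_ge_0|].
  rewrite <- exp_0; apply exp_le_compat; nra.
- rewrite <- (RInt_Chasles (V := R_CompleteNormedModule) _ 0 (INR (length l + p) * d))
    by apply ex_RInt_weighted.
  rewrite Nat.add_succ_r.
  assert (Hb := weighted_block_bound l r d (length l + p) Hr Hd).
  assert (Hp : (9 * exp (- r * d)) ^ (length l + p) <= (1 / 2) ^ S p).
  { apply Rle_trans with ((1 / 2) ^ (length l + p)).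
    - apply pow_incr; split; [|exact Hq]; generalize (exp_pos (- r * d)); lra.
    - replace (length l + p)%nat with (S p + (length l - 1))%nat by lia.
      assert (H1 : (1 / 2) ^ (length l - 1) <= 1 ^ (length l - 1)) by (apply pow_incr; lra).
      assert (H2 : 0 < (1 / 2) ^ S p) by (apply pow_lt; lra).
      rewrite pow1 in H1; rewrite pow_add; nra. }
  apply (Rmult_le_compat_r _ _ _ HI) in Hp.
  change plus with Rplus; change ((1 / 2) ^ S p) with (1 / 2 * (1 / 2) ^ p) in Hp |- *; lra.
Qed.

(** The limit of large [T] in [desum_bound_weighted], by contradiction: an excess [e] > 0 would
    exceed the boundary error W B exp(-r T) for some [T]. *)
Lemma desum_bound_0 (l : list (C * R)) (r d : R) : 0 < r -> 0 < d ->
  (1 <= length l)%nat -> 9 * exp (- r * d) <= 1 / 2 ->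
  Cmod (desum l 0) ^ 2
  <= weight r 0 l * (2 * r * RInt (fun s => Cmod (esum l s) ^ 2) 0 (INR (length l) * d)).
Proof.
intros Hr Hd Hl Hq.
destruct (desum_bound_weighted r (length l) Hr l 0 eq_refl) as [B [HB H]].
assert (HW := weight_nonneg r l 0).
set (I := RInt (fun s => Cmod (esum l s) ^ 2) 0 (INR (length l) * d)).
assert (HI : 0 <= I).
{ apply RInt_ge_0; [|apply ex_RInt_esum_sqr|intros; apply pow2_ge_0].
  apply Rmult_le_pos; [apply pos_INR|lra]. }
set (W := weight r 0 l) in *.
apply Rnot_lt_le; intros Hlt.
set (e := Cmod (desum l 0) ^ 2 - W * (2 * r * I)) in *.
assert (He : 0 < e) by (unfold e; lra).
(* With y = r T > W B / e, the inequality exp y >= 1 + y gives W B exp(-y) < e. *)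
destruct (INR_archimed (r * d) (W * B / e)) as [p Hp]; [nra|].
assert (HT : 0 <= INR (length l + p) * d) by (apply Rmult_le_pos; [apply pos_INR|lra]).
specialize (H _ HT).
replace (desum l 0 - 0 * esum l 0)%C with (desum l 0) in H by ring.
assert (Hw := weighted_integral_bound l r d Hr Hd Hl Hq p); fold I in Hw.
assert (H2 : 0 < (1 / 2) ^ p) by (apply pow_lt; lra).
set (y := r * (INR (length l + p) * d)).
assert (Hy : W * B / e < y).
{ replace y with (INR p * (r * d) + INR (length l) * (r * d))
    by (unfold y; rewrite plus_INR; ring).
  assert (0 <= INR (length l) * (r * d)) by (apply Rmult_le_pos; [apply pos_INR|nra]).
  lra. }
assert (Hey := exp_ineq1_le y).
assert (Hinv : exp (- r * (INR (length l + p) * d)) * exp y = 1).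
{ rewrite <- exp_plus, <- exp_0; f_equal; unfold y; ring. }
assert (Hpos := exp_pos (- r * (INR (length l + p) * d))).
set (E := exp (- r * (INR (length l + p) * d))) in *.
assert (HWB : W * B < e * exp y).
{ apply (Rmult_lt_compat_l e) in Hy; [|exact He].
  replace (e * (W * B / e)) with (W * B) in Hy by (field; lra). nra. }
assert (HWE : W * B * E < e).
{ apply (Rmult_lt_compat_r E) in HWB; [|exact Hpos].
  replace (e * exp y * E) with (e * (E * exp y)) in HWB by ring.
  rewrite Hinv, Rmult_1_r in HWB; exact HWB. }
set (J := RInt _ _ _) in *.
assert (HJ : J <= 2 * I) by nra.
assert (HWJ : W * (r * J) <= W * (r * (2 * I))).
{ apply Rmult_le_compat_l; [exact HW|]; apply Rmult_le_compat_l; lra. }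
unfold e in HWE; lra.
Qed.

(** * Moving the base point and fixing [r] and [d] *)

Definition move (t u : R) (l : list (C * R)) : list (C * R) :=
  map (fun p : C * R => ((fst p * cis (snd p * t))%C, u * snd p)) l.

Lemma esum_move (t u : R) (l : list (C * R)) (s : R) :
  esum (move t u l) s = esum l (u * s + t).
Proof.
induction l as [|[a w] l IH]; [reflexivity|].
cbn [move map fst snd]; fold (move t u l); rewrite !esum_cons, IH.
replace (w * (u * s + t)) with (w * t + u * w * s) by ring.
rewrite cis_plus; ring.
Qed.

Lemma desum_move (t u : R) (l : list (C * R)) :
  desum (move t u l) 0 = (u * desum l t)%C.
Proof.
induction l as [|[a w] l IH]; [cbn; ring|].
cbn [move map fst snd]; fold (move t u l); rewrite !desum_cons, IH.
replace (cis (u * w * 0)) with (RtoC 1).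
- rewrite RtoC_mult; ring.
- rewrite Rmult_0_r; unfold cis; now rewrite cos_0, sin_0.
Qed.

(** Only squares of frequencies enter the weight, so reversing time preserves it. *)
Lemma weight_move (r t u : R) (l : list (C * R)) : u ^ 2 = 1 ->
  forall g, weight r g (move t u l) = weight r g l.
Proof.
intros Hu; induction l as [|[a w] l IH]; intros g; [reflexivity|].
cbn [move map weight fst snd]; fold (move t u l).
rewrite IH, Rpow_mult_distr, Hu; ring.
Qed.

Lemma RInt_move_le (F : R -> R) (t u : R) : (forall x, continuous F x) ->
  (forall x, 0 <= F x) -> 0 <= t <= 1 -> 0 <= t + u / 2 <= 1 -> u = 1 \/ u = -1 ->
  RInt (fun s => F (u * s + t)) 0 (1 / 2) <= RInt F 0 1.
Proof.
intros HF HF0 Ht Htu Hu.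
assert (Hex : forall a b, ex_RInt F a b).
{ intros a b; apply (ex_RInt_continuous (V := R_CompleteNormedModule)); auto. }
assert (Hmono : forall a b, 0 <= a -> a <= b -> b <= 1 -> RInt F a b <= RInt F 0 1).
{ intros a b Ha Hab Hb.
  rewrite <- (RInt_Chasles (V := R_CompleteNormedModule) F 0 a 1) by auto.
  rewrite <- (RInt_Chasles (V := R_CompleteNormedModule) F a b 1) by auto.
  change plus with Rplus.
  generalize (RInt_ge_0 F 0 a Ha (Hex _ _) (fun x _ => HF0 x))
    (RInt_ge_0 F b 1 Hb (Hex _ _) (fun x _ => HF0 x)); lra. }
assert (H := RInt_affine F u t 0 (1 / 2) HF).
rewrite Rmult_0_r, Rplus_0_l in H.
destruct Hu as [-> | ->].
- rewrite Rmult_1_l in H; rewrite H; apply Hmono; lra.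
(* For u = -1 the substitution reverses the orientation. *)
- rewrite <- (opp_RInt_swap (V := R_CompleteNormedModule) F (-1 * (1 / 2) + t) t (Hex _ _)) in H.
  change opp with Ropp in H.
  apply Rle_trans with (RInt F (-1 * (1 / 2) + t) t); [lra|apply Hmono; lra].
Qed.

Lemma desum_bound (l : list (C * R)) (t : R) : (1 <= length l)%nat -> 0 <= t <= 1 ->
  Cmod (desum l t) ^ 2
  <= weight (9 * INR (length l)) 0 l
     * (18 * INR (length l) * RInt (fun s => Cmod (esum l s) ^ 2) 0 1).
Proof.
intros Hl Ht.
set (n := INR (length l)).
assert (Hn : 1 <= n) by (apply (le_INR 1); exact Hl).
(* Go forwards from the left half of [0, 1] and backwards from the right half. *)
assert (Hu : exists u, 0 <= t + u / 2 <= 1 /\ (u = 1 \/ u = -1)).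
{ destruct (Rle_dec t (1 / 2)); [exists 1|exists (-1)]; split; (lra || tauto). }
destruct Hu as [u [Htu Hu]].
assert (Hlen : length (move t u l) = length l) by apply length_map.
assert (Hu2 : u ^ 2 = 1) by (destruct Hu as [-> | ->]; ring).
(* With d = 1/(2n) the first n blocks fill [0, 1/2], and r = 9n gives r d = 9/2. *)
assert (H := desum_bound_0 (move t u l) (9 * n) (/ (2 * n))).
rewrite Hlen, weight_move, desum_move, Cmod_mult, Cmod_R, Rpow_mult_distr in H by exact Hu2.
rewrite pow2_abs, Hu2, Rmult_1_l in H; fold n in H.
replace (n * / (2 * n)) with (1 / 2) in H by (field; lra).
replace (- (9 * n) * / (2 * n)) with (- (9 / 2)) in H by (field; lra).
(* This amounts to exp(9/2) >= 18, which follows from exp(3/4) >= 7/4 and (7/4)^6 > 28. *)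
assert (He : 9 * exp (- (9 / 2)) <= 1 / 2).
{ assert (H1 := exp_ineq1_le (3 / 4)); assert (H2 := exp_pos (3 / 4)).
  assert (E : exp (- (9 / 2)) * exp (3 / 4) ^ 6 = 1).
  { rewrite exp_pow, <- exp_plus, <- exp_0; f_equal; cbn; lra. }
  assert (H3 : (7 / 4) ^ 6 <= exp (3 / 4) ^ 6) by (apply pow_incr; lra).
  assert (H4 := exp_pos (- (9 / 2))).
  assert (H5 : 18 <= exp (3 / 4) ^ 6) by lra.
  nra. }
eapply Rle_trans; [apply H; [lra|apply Rinv_0_lt_compat; lra|exact Hl|exact He]|].
apply Rmult_le_compat_l; [apply weight_nonneg|].
replace (2 * (9 * n)) with (18 * n) by ring.
apply Rmult_le_compat_l; [lra|].
rewrite (RInt_ext _ (fun s => Cmod (esum l (u * s + t)) ^ 2))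
  by (intros s _; now rewrite esum_move).
apply (RInt_move_le (fun s => Cmod (esum l s) ^ 2)); try assumption.
- intros x; apply continuous_esum_sqr.
- intros x; apply pow2_ge_0.
Qed.

(** * Translation to real and imaginary parts, and the final constants *)

Definition terms (ar ai lam : nat -> R) (ks : list nat) : list (C * R) :=
  map (fun j => ((ar j, ai j), lam j)) ks.

Lemma esum_terms (n : nat) (ar ai lam : nat -> R) (t : R) :
  esum (terms ar ai lam (seq 0 n)) t = (f_re n ar ai lam t, f_im n ar ai lam t).
Proof.
unfold f_re, f_im, rsum; induction (seq 0 n) as [|k ks IH]; [reflexivity|].
cbn [terms map]; fold (terms ar ai lam ks); rewrite esum_cons, IH.
unfold Cplus, Cmult, cis; cbn; f_equal; ring.
Qed.

Lemma desum_terms (n : nat) (ar ai lam : nat -> R) (t : R) :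
  desum (terms ar ai lam (seq 0 n)) t = (df_re n ar ai lam t, df_im n ar ai lam t).
Proof.
unfold df_re, df_im, rsum; induction (seq 0 n) as [|k ks IH]; [reflexivity|].
cbn [terms map]; fold (terms ar ai lam ks); rewrite desum_cons, IH.
unfold Cplus, Cmult, cis; cbn; f_equal; ring.
Qed.

(** The frequency parts agree exactly, since 729 * 2 / 81 = 18. For the shifts, 18 * 81 = 1458 is a
    quarter of 729 * 8 = 5832. *)
Lemma weight_terms (N : R) (ar ai lam : nat -> R) (n : nat) : 0 < N ->
  18 * N * weight (9 * N) 0 (terms ar ai lam (seq 0 n))
  <= 729 * N ^ 3 * rsum n (fun k => 2 * (lam k / (9 * N)) ^ 2 + 8 * INR k ^ 2).
Proof.
intros HN; unfold rsum.
(* The start [b] is general because the shift has reached 9 N b when index b comes first. *)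
assert (H : forall b, 18 * N * weight (9 * N) (9 * N * INR b) (terms ar ai lam (seq b n))
  <= 729 * N ^ 3 * fold_right
       (fun k acc => 2 * (lam k / (9 * N)) ^ 2 + 8 * INR k ^ 2 + acc) 0 (seq b n)).
2: { specialize (H 0%nat); rewrite Rmult_0_r in H; exact H. }
induction n as [|n IH]; intros b; cbn [seq terms map weight fold_right snd].
- lra.
- fold (terms ar ai lam (seq (S b) n)).
  specialize (IH (S b)); rewrite S_INR in IH.
  replace (9 * N * (INR b + 1)) with (9 * N * INR b + 9 * N) in IH by ring.
  set (V := weight _ _ _) in *; set (U := fold_right _ _ _) in *.
  replace (729 * N ^ 3 * (2 * (lam b / (9 * N)) ^ 2 + 8 * INR b ^ 2 + U))
    with (18 * N * lam b ^ 2 + 5832 * (N ^ 3 * INR b ^ 2) + 729 * N ^ 3 * U) by (field; lra).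
  assert (0 <= N ^ 3 * INR b ^ 2) by (apply Rmult_le_pos; [apply pow_le; lra|apply pow2_ge_0]).
  lra.
Qed.

Theorem theorem5p2 (n : nat) (hn : (1 <= n)%nat) (ar ai lam : nat -> R)
  (hlam : forall i j : nat, (i < j < n)%nat -> lam i < lam j)
  (pr : Riemann_integrable
          (fun t => (f_re n ar ai lam t) ^ 2 + (f_im n ar ai lam t) ^ 2) 0 1) :
  forall t : R, 0 <= t <= 1 ->
    cmod (df_re n ar ai lam t) (df_im n ar ai lam t)
    <= 27 * (1 + eps_n n) * (INR n * sqrt (INR n))
       * sqrt (rsum n (fun k => 2 * (lam k / (9 * INR n)) ^ 2 + 8 * (INR k) ^ 2))
       * sqrt (RiemannInt pr).
Proof.
intros t Ht.
set (l := terms ar ai lam (seq 0 n)).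
assert (Hl : length l = n) by (unfold l, terms; now rewrite length_map, length_seq).
assert (HN : 1 <= INR n) by (apply (le_INR 1); exact hn).
assert (H := desum_bound l t ltac:(lia) Ht).
rewrite Hl in H.
assert (HI : RInt (fun s => Cmod (esum l s) ^ 2) 0 1 = RiemannInt pr).
{ rewrite <- RInt_Reals; apply RInt_ext; intros s _.
  now unfold l; rewrite esum_terms, Cmod_sqr. }
assert (HI0 : 0 <= RiemannInt pr).
{ rewrite <- HI; apply RInt_ge_0; [lra|apply ex_RInt_esum_sqr|intros; apply pow2_ge_0]. }
rewrite HI in H.
assert (HW := weight_terms (INR n) ar ai lam n ltac:(lra)); fold l in HW.
replace (cmod _ _) with (Cmod (desum l t)) by (unfold l; now rewrite desum_terms).
set (I := RiemannInt pr) in *.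
set (U := rsum n _) in *.
set (N := INR n) in *.
assert (HW0 := weight_nonneg (9 * N) l 0).
assert (HN3 : 0 < N ^ 3) by (apply pow_lt; lra).
assert (HU : 0 <= U) by nra.
(* Here 729 N^3 is the square of 27 N sqrt(N). *)
assert (Hsq : Cmod (desum l t) ^ 2 <= (27 * (N * sqrt N) * sqrt U * sqrt I) ^ 2).
{ rewrite !Rpow_mult_distr, !pow2_sqrt by lra.
  apply (Rmult_le_compat_r I) in HW; [nra|exact HI0]. }
assert (HR0 : 0 <= 27 * (N * sqrt N) * sqrt U * sqrt I).
{ repeat apply Rmult_le_pos; try apply sqrt_pos; lra. }
(* The factor 1 + eps_n is at least 1, so inserting it only enlarges the right side. *)
assert (Heps : 1 <= 1 + eps_n n).
{ unfold eps_n; assert (Hs := sqrt_le_1_alt 1 (1 + 8190 * exp (- INR n / 10))).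
  rewrite sqrt_1 in Hs; generalize (exp_pos (- INR n / 10)); lra. }
apply Rle_trans with (27 * (N * sqrt N) * sqrt U * sqrt I).
- rewrite <- !Rsqr_pow2 in Hsq; exact (Rsqr_incr_0_var _ _ Hsq HR0).
- replace (27 * (1 + eps_n n) * (N * sqrt N) * sqrt U * sqrt I)
    with ((1 + eps_n n) * (27 * (N * sqrt N) * sqrt U * sqrt I)) by ring.
  nra.
Qed.
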